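(* Let $R$ be a ring, let $M$ be a right $R$-module, let $E:=\operatorname{End}_R(M)$, and let $N$ be a maximal submodule of $M$. Then either $\mathbb{I}(N)=E$ (i.e., $N$ is fully invariant in $M$), or $N$ is similar to at least $1+|\mathbb{E}(N)|$ distinct maximal $R$-submodules of $M$. In particular, in the latter case, $|\operatorname{Max}(M)|\geq 1+|\mathbb{E}(N)|\geq 3$.
   Context: Rings are unital with $1\neq 0$; modules are right unital modules; endomorphisms act on the left. $\operatorname{Max}(M)$ denotes the set of maximal submodules of $M$. For a submodule $N$ of $M$ and $E=\operatorname{End}_R(M)$: $\operatorname{Hom}_R(M,N)$ is identified with the right ideal $\{\beta\in E\mid \beta(M)\subseteq N\}$ of $E$; $\mathbb{I}(N):=\{\beta\in E\mid \beta(N)\subseteq N\}$ is the idealizer of $N$, a subring of $E$ in which $\operatorname{Hom}_R(M,N)$ is a two-sided ideal; $\mathbb{E}(N):=\mathbb{I}(N)/\operatorname{Hom}_R(M,N)$ is the eigenring of $N$. $N$ is fully invariant if $\beta(N)\subseteq N$ for all $\beta\in E$. Submodules $N,N'$ of $M$ are similar if $M/N\cong M/N'$ as $R$-modules (so $N$ is similar to itself). $|X|$ denotes the cardinality of $X$. *)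

(* Defs.v *)
From HB Require Import structures.
From mathcomp Require Import all_boot all_order all_algebra.
From mathcomp Require Import all_classical.

Set Implicit Arguments.
Unset Strict Implicit.
Unset Printing Implicit Defensive.

Import GRing.Theory.
Local Open Scope ring_scope.
Local Open Scope quotient_scope.
Local Open Scope classical_set_scope.

(* All notions are set up for left modules over an arbitrary ring.  A right   *)
(* R-module is an lmodType over the converse ring R^c: writing u.b for        *)
(* b *: u, the axiom a *: (b *: u) = ((a : R^c) * b) *: u says that           *)
(* (u.b).a = u.(b * a), the last product being taken in R.                    *)
(*   Submodules are the submodClosed predicates.  These are boolean, but      *)
(* asbool turns any Prop-valued submodule into one of them.                   *)

(* Leibniz equality of submodules is equality of the underlying subsets, so   *)
(* cardinalities of sets of submodules count distinct subsets.                *)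
Lemma submod_ext (R : pzRingType) (M : lmodType R) (N N' : submodClosed M) :
  N =i N' -> N = N'.
Proof.
case: N => N [[a1] [z1]]; case: N' => N' [[a2] [z2]] eqNN'.
have eqN : N = N' by apply/funext => x; exact: (eqNN' x).
move: a1 z1 a2 z2 {eqNN'}; rewrite {}eqN => a1 z1 a2 z2.
by rewrite (Prop_irrelevance a1 a2) (Prop_irrelevance z1 z2).
Qed.

Section QuotientModule.
Variables (R : pzRingType) (M : lmodType R) (N : submodClosed M).

Lemma submod_oppr_closed : oppr_closed N.
Proof. by move=> x xN; rewrite -scaleN1r rpredZ. Qed.

Definition submod_zmod : zmodClosed M :=
  HB.pack_for (zmodClosed M) (GRing.SubmodClosed.sort N)
    (GRing.isOppClosed.Build M N submod_oppr_closed).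

Definition quotmod : Type := Quotient.quot submod_zmod.

HB.instance Definition _ := GRing.Zmodule.on quotmod.
HB.instance Definition _ := Quotient.on quotmod.
HB.instance Definition _ :=
  isEqQuotient.Build M (Quotient.equiv submod_zmod) quotmod
    (@pi_eq_quot _ _ (Quotient.quot submod_zmod)).
HB.instance Definition _ :=
  @isZmodQuotient.Build M (Quotient.equiv submod_zmod) 0 -%R +%R quotmod
    (@pi_zeror _ _ _ _ _ (Quotient.quot submod_zmod))
    (@pi_oppr _ _ _ _ _ (Quotient.quot submod_zmod))
    (@pi_addr _ _ _ _ _ (Quotient.quot submod_zmod)).

Lemma quotmod_eqE (x y : M) : (x == y %[mod quotmod]) = (x - y \in N).
Proof. by rewrite piE. Qed.

Definition quotmod_scale (a : R) : quotmod -> quotmod :=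
  lift_op1 quotmod ( *:%R a).

Lemma pi_quotmod_scale (a : R) :
  {morph \pi_quotmod : x / a *: x >-> quotmod_scale a x}.
Proof.
move=> x; unlock quotmod_scale; apply/eqP.
rewrite quotmod_eqE -scalerBr rpredZ //.
by rewrite -quotmod_eqE reprK.
Qed.

Fact quotmod_scaleA a b u :
  quotmod_scale a (quotmod_scale b u) = quotmod_scale (a * b) u.
Proof. by elim/quotW: u => x; rewrite -!pi_quotmod_scale scalerA. Qed.

Fact quotmod_scale1 : left_id 1 quotmod_scale.
Proof. by elim/quotW => x; rewrite -pi_quotmod_scale scale1r. Qed.

Fact quotmod_scaleDr : right_distributive quotmod_scale +%R.
Proof.
move=> a; elim/quotW => x; elim/quotW => y.
by rewrite -!pi_quotmod_scale -!pi_addr -pi_quotmod_scale scalerDr.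
Qed.

Fact quotmod_scaleDl u : {morph quotmod_scale^~ u : a b / a + b}.
Proof.
by elim/quotW: u => x a b; rewrite -!pi_quotmod_scale -pi_addr scalerDl.
Qed.

HB.instance Definition _ := GRing.Zmodule_isLmodule.Build R quotmod
  quotmod_scaleA quotmod_scale1 quotmod_scaleDr quotmod_scaleDl.

End QuotientModule.

Section Submodules.
Variables (R : pzRingType) (M : lmodType R).
Implicit Types N L : submodClosed M.

Definition maximal_submod N :=
  ~ (forall x, x \in N) /\
  (forall L, {subset N <= L} -> {subset L <= N} \/ (forall x, x \in L)).

Definition Max : set (submodClosed M) := [set N | maximal_submod N].

Definition similar_submod N L :=
  exists f : {linear quotmod N -> quotmod L}, bijective f.

End Submodules.

Arguments Max {R} M.

Section EndomorphismRing.
Variables (R : pzRingType) (M : lmodType R).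

Definition endo : Type := {linear M -> M}.

HB.instance Definition _ := gen_eqMixin endo.
HB.instance Definition _ := gen_choiceMixin endo.

Lemma endoP (f g : endo) : f =1 g -> f = g.
Proof.
case: f => f [[f1] [f2]]; case: g => g [[g1] [g2]] /= /funext eqfg.
move: f1 f2 g1 g2; rewrite {}eqfg => f1 f2 g1 g2.
by rewrite (Prop_irrelevance f1 g1) (Prop_irrelevance f2 g2).
Qed.

Definition endo_zero : endo := \0 : {linear M -> M}.
Definition endo_one : endo := idfun : {linear M -> M}.
Definition endo_opp (f : endo) : endo := (\- f) : {linear M -> M}.
Definition endo_add (f g : endo) : endo := (f \+ g) : {linear M -> M}.
Definition endo_mul (f g : endo) : endo := (f \o g) : {linear M -> M}.

Fact endo_addA : associative endo_add.
Proof. by move=> f g h; apply: endoP => x /=; rewrite addrA. Qed.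

Fact endo_addC : commutative endo_add.
Proof. by move=> f g; apply: endoP => x /=; rewrite addrC. Qed.

Fact endo_add0 : left_id endo_zero endo_add.
Proof. by move=> f; apply: endoP => x /=; rewrite add0r. Qed.

Fact endo_addN : left_inverse endo_zero endo_opp endo_add.
Proof. by move=> f; apply: endoP => x /=; rewrite addNr. Qed.

HB.instance Definition _ :=
  GRing.isZmodule.Build endo endo_addA endo_addC endo_add0 endo_addN.

Fact endo_mulA : associative endo_mul.
Proof. by move=> f g h; apply: endoP. Qed.

Fact endo_mul1 : left_id endo_one endo_mul.
Proof. by move=> f; apply: endoP. Qed.

Fact endo_mulr1 : right_id endo_one endo_mul.
Proof. by move=> f; apply: endoP. Qed.

Fact endo_mulDl : left_distributive endo_mul endo_add.
Proof. by move=> f g h; apply: endoP. Qed.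

Fact endo_mulDr : right_distributive endo_mul endo_add.
Proof. by move=> f g h; apply: endoP => x /=; rewrite raddfD. Qed.

HB.instance Definition _ := GRing.Zmodule_isPzRing.Build endo
  endo_mulA endo_mul1 endo_mulr1 endo_mulDl endo_mulDr.

End EndomorphismRing.

Section Eigenring.
Variables (R : pzRingType) (M : lmodType R) (N : submodClosed M).

Definition fully_invariant := forall b : endo M, {homo b : x / x \in N}.

Definition idealizer : {pred endo M} :=
  [pred b : endo M | `[< {homo b : x / x \in N} >]].

Definition hom_into : {pred endo M} :=
  [pred b : endo M | `[< forall x, b x \in N >]].

Lemma idealizerP (b : endo M) :
  reflect {homo b : x / x \in N} (b \in idealizer).
Proof. exact: asboolP. Qed.

Lemma hom_intoP (b : endo M) : reflect (forall x, b x \in N) (b \in hom_into).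
Proof. exact: asboolP. Qed.

Fact idealizer_subring : subring_closed idealizer.
Proof.
split=> [|f g|f g]; first by apply/idealizerP.
- move=> /idealizerP fN /idealizerP gN; apply/idealizerP => x xN.
  by apply: (@rpredB _ (submod_zmod N)); [exact: fN | exact: gN].
- move=> /idealizerP fN /idealizerP gN; apply/idealizerP => x xN.
  exact/fN/gN.
Qed.

HB.instance Definition _ :=
  GRing.isSubringClosed.Build (endo M) idealizer idealizer_subring.

Record idealizer_ring :=
  IdealizerRing { idealizer_val :> endo M; _ : idealizer_val \in idealizer }.

HB.instance Definition _ := [isSub for idealizer_val].
HB.instance Definition _ := [Choice of idealizer_ring by <:].
HB.instance Definition _ :=
  GRing.SubChoice_isSubPzRing.Build (endo M) idealizer idealizer_ring
    idealizer_subring.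

(* Hom_R(M, N) as a two-sided ideal of the ring I(N), in which it is          *)
(* contained (hom_into_idealizer).                                            *)
Definition hom_ideal : {pred idealizer_ring} :=
  [pred b : idealizer_ring | val b \in hom_into].

Lemma hom_into_idealizer : {subset hom_into <= idealizer}.
Proof. by move=> f /hom_intoP fN; apply/idealizerP => x _; apply: fN. Qed.

Fact hom_ideal_zmod_closed : zmod_closed hom_ideal.
Proof.
split=> [|f g]; first by apply/hom_intoP => x; exact: rpred0.
move=> /hom_intoP fN /hom_intoP gN; apply/hom_intoP => x.
by apply: (@rpredB _ (submod_zmod N)); [exact: fN | exact: gN].
Qed.

HB.instance Definition _ :=
  GRing.isZmodClosed.Build idealizer_ring hom_ideal hom_ideal_zmod_closed.

Lemma hom_ideal_mull (f g : idealizer_ring) :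
  g \in hom_ideal -> f * g \in hom_ideal.
Proof.
move=> /hom_intoP gN; apply/hom_intoP => x.
by have /idealizerP fN := valP f; exact/fN/gN.
Qed.

Lemma hom_ideal_mulr (f g : idealizer_ring) :
  f \in hom_ideal -> f * g \in hom_ideal.
Proof. by move=> /hom_intoP fN; apply/hom_intoP => x; apply: fN. Qed.

(* The library only equips quotients of commutative rings with a ring         *)
(* structure, so that of I(N) / Hom_R(M, N) is built here.  It may be the     *)
(* zero ring (when N = M), whence pzRingType.                                 *)
Definition eigenring : Type := Quotient.quot hom_ideal.

HB.instance Definition _ := GRing.Zmodule.on eigenring.
HB.instance Definition _ := Quotient.on eigenring.
HB.instance Definition _ :=
  isEqQuotient.Build idealizer_ring (Quotient.equiv hom_ideal) eigenring
    (@pi_eq_quot _ _ (Quotient.quot hom_ideal)).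
HB.instance Definition _ :=
  @isZmodQuotient.Build idealizer_ring (Quotient.equiv hom_ideal) 0 -%R +%R
    eigenring
    (@pi_zeror _ _ _ _ _ (Quotient.quot hom_ideal))
    (@pi_oppr _ _ _ _ _ (Quotient.quot hom_ideal))
    (@pi_addr _ _ _ _ _ (Quotient.quot hom_ideal)).

Lemma eigenring_eqE (f g : idealizer_ring) :
  (f == g %[mod eigenring]) = (f - g \in hom_ideal).
Proof. by rewrite piE. Qed.

Definition eigenring_one : eigenring := \pi_eigenring 1.
Definition eigenring_mul := lift_op2 eigenring *%R.

Lemma pi_eigenring_mul :
  {morph \pi_eigenring : f g / f * g >-> eigenring_mul f g}.
Proof.
move=> f g; unlock eigenring_mul; apply/eqP; rewrite eigenring_eqE.
set f' := repr _; set g' := repr _.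
have -> : f * g - f' * g' = f * (g - g') + (f - f') * g'.
  by rewrite mulrBr mulrBl addrA subrK.
apply: rpredD; [apply: hom_ideal_mull | apply: hom_ideal_mulr];
  by rewrite -eigenring_eqE reprK.
Qed.

Fact eigenring_mulA : associative eigenring_mul.
Proof.
elim/quotW => f; elim/quotW => g; elim/quotW => h.
by rewrite -!pi_eigenring_mul mulrA.
Qed.

Fact eigenring_mul1 : left_id eigenring_one eigenring_mul.
Proof. by elim/quotW => f; rewrite -pi_eigenring_mul mul1r. Qed.

Fact eigenring_mulr1 : right_id eigenring_one eigenring_mul.
Proof. by elim/quotW => f; rewrite -pi_eigenring_mul mulr1. Qed.

Fact eigenring_mulDl : left_distributive eigenring_mul +%R.
Proof.
elim/quotW => f; elim/quotW => g; elim/quotW => h.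
by rewrite -pi_addr -!pi_eigenring_mul -pi_addr mulrDl.
Qed.

Fact eigenring_mulDr : right_distributive eigenring_mul +%R.
Proof.
elim/quotW => f; elim/quotW => g; elim/quotW => h.
by rewrite -pi_addr -!pi_eigenring_mul -pi_addr mulrDr.
Qed.

HB.instance Definition _ := GRing.Zmodule_isPzRing.Build eigenring
  eigenring_mulA eigenring_mul1 eigenring_mulr1 eigenring_mulDl eigenring_mulDr.

End Eigenring.

(* Main.v *)
(* Let S = M / N, a simple module, let p : M -> S be the projection and let b *)
(* be an endomorphism of M with b(N) not contained in N.  For e in I(N), the  *)
(* map p (b - e) is nonzero, even on N, hence onto S, and its kernel K_e is a *)
(* maximal submodule similar to N and different from N.  If K_e = K_e', then  *)
(* e - e' maps both N and K_e into N; since N + K_e = M, it maps M into N.    *)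
(* So the K_e, together with N, are 1 + |E(N)| distinct submodules.           *)

From HB Require Import structures.
Require Import Defs.
From mathcomp Require Import all_boot all_order all_algebra.
From mathcomp Require Import all_classical.

Set Implicit Arguments.
Unset Strict Implicit.
Unset Printing Implicit Defensive.

Import GRing.Theory.
Local Open Scope ring_scope.
Local Open Scope classical_set_scope.
Local Open Scope card_scope.

(** Simplicity of M/N, used in the elementwise form M = N + Ry for y outside N, drives everything.
    It makes the preimage of N under any endomorphism g with g(M) not inside N maximal
    ([preim_submod_maximal]) and similar to N ([preim_submod_similar]). If b moves some n in N out
    of N, this applies to all b - e with e in the idealizer, and the same n then separates N from
    each of these preimages. Distinct classes e give distinct preimages ([twist_inj]), and the bound
    3 comes from 0 and 1 being distinct in the eigenring. *)

Section Submodules.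
Local Open Scope quotient_scope.
Variables (R : pzRingType) (M : lmodType R).
Implicit Types (N L : submodClosed M) (g : {linear M -> M}).

Lemma submodB N x y : x \in N -> y \in N -> x - y \in N.
Proof. exact: (@rpredB _ (submod_zmod N)). Qed.

Definition add_line N (y : M) : {pred M} :=
  [pred x | `[< exists a, x - a *: y \in N >]].

Fact add_line_submod_closed N y : submod_closed (add_line N y).
Proof.
split=> [|a u v /asboolP[b ub] /asboolP[c vc]]; apply/asboolP.
  by exists 0; rewrite scale0r subr0 rpred0.
exists (a * b + c); rewrite scalerDl -scalerA opprD addrACA -scalerBr.
by rewrite rpredD // rpredZ.
Qed.

HB.instance Definition _ N y := GRing.isSubmodClosed.Build R M (add_line N y)
  (GRing.submod_closed_semi (add_line_submod_closed N y)).

(** N + Ry is a submodule strictly larger than N, hence all of M; equivalently, every nonzero class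
    generates M/N. *)
Lemma maximal_submod_line N x y :
  maximal_submod N -> y \notin N -> exists a, x - a *: y \in N.
Proof.
case=> _ maxN yN; have [z zN||/(_ x)/asboolP//] := maxN (add_line N y).
  by apply/asboolP; exists 0; rewrite scale0r subr0.
move/(_ y) => sLN; case/negP: yN; apply/sLN/asboolP.
by exists 1; rewrite scale1r subrr rpred0.
Qed.

Definition preim_submod g N : {pred M} := [pred x | g x \in N].

Fact preim_submod_closed g N : submod_closed (preim_submod g N).
Proof.
split=> [|a u v]; rewrite !inE ?linear0 ?rpred0 // => uN vN.
by rewrite linearP rpredD // rpredZ.
Qed.

HB.instance Definition _ g N := GRing.isSubmodClosed.Build R M
  (preim_submod g N) (GRing.submod_closed_semi (preim_submod_closed g N)).

(** If L contains the preimage and some z with g z outside N, then g x is a multiple of g z modulo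
    N, so x differs from a multiple of z by an element of the preimage. *)
Lemma preim_submod_maximal g N y :
  maximal_submod N -> g y \notin N -> maximal_submod (preim_submod g N).
Proof.
move=> maxN gyN; split=> [/(_ y)|L sPL]; first by apply/negP.
have [|/existsNP[z /not_implyP[zL /negP gzN]]] :=
  pselect {subset L <= preim_submod g N}; first by left.
right=> x; have [a xa] := maximal_submod_line (g x) maxN gzN.
rewrite -(subrK (a *: z) x) rpredD ?rpredZ //.
by apply: sPL; rewrite inE linearB linearZ.
Qed.

Lemma pi_quotmodP N x y : \pi_(quotmod N) x = \pi_(quotmod N) y <-> x - y \in N.
Proof. by rewrite -quotmod_eqE; split=> [->|/eqP]. Qed.

Lemma repr_quotmodB N x : repr (\pi_(quotmod N) x) - x \in N.
Proof. by apply/pi_quotmodP; rewrite reprK. Qed.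

Lemma pi_quotmod_linear N : linear (\pi_(quotmod N)).
Proof. by move=> a x y; rewrite pi_addr pi_quotmod_scale. Qed.

(** First isomorphism theorem for the composite of g with the projection to M/N, which is onto
    because the class of g y generates M/N. *)
Lemma preim_submod_similar g N y : maximal_submod N -> g y \notin N ->
  similar_submod N (preim_submod g N).
Proof.
move=> maxN gyN; set P : submodClosed M := preim_submod g N.
have surj (u : quotmod N) : exists x, \pi_(quotmod N) (g x) = u.
  have [a xa] := maximal_submod_line (repr u) maxN gyN.
  exists (a *: y); rewrite -[RHS]reprK; apply/esym/pi_quotmodP.
  by rewrite linearZ.
(* [s] is an arbitrary set-theoretic section; it becomes linear modulo [P], the kernel of that
   composite. *)
pose s u := projT1 (cid (surj u)).
have sK u : \pi_(quotmod N) (g (s u)) = u by exact: projT2 (cid (surj u)).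
pose f u : quotmod P := \pi_(quotmod P) (s u).
have f_linear : linear f.
  move=> a u v; rewrite /f -pi_quotmod_linear; apply/pi_quotmodP.
  rewrite inE linearB; apply/pi_quotmodP.
  by rewrite linearP pi_quotmod_linear !sK.
pose F : {linear quotmod N -> quotmod P} :=
  HB.pack f (GRing.isLinear.Build _ _ _ _ f f_linear).
exists F; exists (fun v => \pi_(quotmod N) (g (repr v))) => [u|v] /=.
  rewrite -[RHS]sK; apply/pi_quotmodP; rewrite -linearB.
  by have := repr_quotmodB P (s u); rewrite inE.
rewrite /f -[RHS]reprK; apply/pi_quotmodP.
by rewrite inE linearB; apply/pi_quotmodP; rewrite sK.
Qed.

Lemma similar_submod_refl N : similar_submod N N.
Proof. by exists idfun; exists idfun. Qed.

End Submodules.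

Lemma inj_card_leP T U (A : set T) (B : set U) (f : T -> U) :
  {in A &, injective f} -> (forall x, A x -> B (f x)) -> A #<= B.
Proof.
move=> f_inj fAB; apply: (@card_le_trans _ _ _ (f @` A)).
  by rewrite (card_le_eqr (inj_card_eq f_inj)).
by apply: subset_card_le => _ [x Ax <-]; apply: fAB.
Qed.

(** If 1 were 0, the identity would map M into N, which is proper. *)
Lemma eigenring_neq01 (R : pzRingType) (M : lmodType R) (N : submodClosed M) :
  maximal_submod N -> 0 <> 1 :> eigenring N.
Proof.
case=> nN _ eq01; apply: nN => x.
have /eqP : (1 = 0 %[mod eigenring N])%qT by rewrite pi_zeror eq01.
by rewrite eigenring_eqE subr0 => /hom_intoP/(_ x).
Qed.

Section NonInvariant.
Variables (R : pzRingType) (M : lmodType R) (N : submodClosed M).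
Variables (b : endo M) (n : M).
Hypotheses (maxN : maximal_submod N) (nN : n \in N) (bnN : b n \notin N).

(** [None] accounts for the summand 1, namely N itself. The choice of representative is harmless:
    changing it alters b - e by a map into N. *)
Definition twist (u : option (eigenring N)) : submodClosed M :=
  if u is Some e then preim_submod (b - val (repr e) : endo M) N else N.

Lemma idealizer_subN (e : idealizer_ring N) : (b - val e : endo M) n \notin N.
Proof.
apply: contraNN bnN => ben; rewrite -[b n](subrK (val e n)) rpredD //.
by have /idealizerP := valP e; apply.
Qed.

Lemma twist_similar u : Max M (twist u) /\ similar_submod N (twist u).
Proof.
case: u => [e|] /=; last by split=> //; exact: similar_submod_refl.
split; first exact: preim_submod_maximal maxN (idealizer_subN (repr e)).
exact: preim_submod_similar maxN (idealizer_subN (repr e)).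
Qed.

Lemma twist_SomeN e : n \notin twist (Some e).
Proof. exact: idealizer_subN. Qed.

Lemma twist_inj : injective twist.
Proof.
move=> [e|] [e'|] // eqK; last 2 first.
- by have := twist_SomeN e; rewrite eqK /= nN.
- by have := twist_SomeN e'; rewrite -eqK /= nN.
congr Some; rewrite -[e]reprK -[e']reprK; apply/eqP.
rewrite eigenring_eqE; apply/hom_intoP => x.
set d := val _.
have dN y : y \in N -> d y \in N 
  by have /idealizerP := valP (repr e - repr e'); apply.
(* On the common preimage, e - e' is the difference of b - e' and b - e, both of which land in N. *)
have dK y : y \in twist (Some e) -> d y \in N.
  move=> yK; have yK' : y \in twist (Some e') by rewrite -eqK.
  have -> : d y = (b - val (repr e') : endo M) y - (b - val (repr e) : endo M) y.
    by rewrite /d /= opprB addrCA (addrAC (b y)) subrr add0r.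
  exact: submodB.
(* The preimage is maximal and misses n, so together with n it spans M; [d] sends both into N. *)
have [a xa] := maximal_submod_line x (twist_similar (Some e)).1 (twist_SomeN e).
have -> : d x = d (x - a *: n) + a *: d n by rewrite -linearZ -linearD subrK.
by apply: rpredD; [exact: dK xa | exact: (rpredZ a (dN n nN))].
Qed.

End NonInvariant.

Theorem theorem3p2 (R : nzRingType) (M : lmodType R^c) (N : submodClosed M)
    (hN : Max M N) :
  (idealizer N =i predT <-> fully_invariant N) /\
  (idealizer N =i predT \/
   [/\ [set: option (eigenring N)] #<= [set N' | Max M N' /\ similar_submod N N'],
       [set: option (eigenring N)] #<= Max M
     & `I_3 #<= [set: option (eigenring N)]]).
Proof.
have IE : idealizer N =i predT <-> fully_invariant N.
  split=> [IT b|inv b]; first by apply/idealizerP; rewrite IT.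
  by rewrite [RHS]inE; apply/idealizerP/inv.
split=> //.
have [/IE|/existsNP[b /existsNP[n /not_implyP[nN /negP bnN]]]] :=
  pselect (fully_invariant N); first by left.
have inj := twist_inj hN nN bnN; right; split.
- by apply: (inj_card_leP (in2W inj)) => u _; exact: twist_similar nN bnN _.
- by apply: (inj_card_leP (in2W inj)) => u _; have [] := twist_similar hN nN bnN u.
(* Three distinct elements: the added point, 0 and 1. *)
pose f i : option (eigenring N) :=
  match i with 0%N => None | 1%N => Some 0 | _ => Some 1 end.
have neq01 := eigenring_neq01 hN.
apply: (@inj_card_leP _ _ _ _ f) => // i j; rewrite !inE /=.
case: i => [|[|[|//]]] _; case: j => [|[|[|//]]] _ //= -[eq01];
  by case: neq01.
Qed.
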